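(* Let $X$ be a complex Banach space, let $T \in L(X)$ and let $\Phi=(\Phi_1,\Phi_2)$ be a spectral a-partitioning function for $T$. If $\Psi=(\Psi_1,\Psi_2)$ is a spectral valued function such that $\Psi \leq \Phi$, then $\Psi$ is a spectral partitioning function for $T$ if and only if $\Psi_1(T) \setminus \Phi_1(T) = (\Phi_2(T) \setminus \Psi_2(T)) \bigsqcup (\sigma(T)\setminus \sigma_a(T))$.
   Context: $L(X)$ is the Banach algebra of bounded linear operators on $X$; $\sigma(T)$ is the spectrum and $\sigma_a(T)$ the approximate point spectrum of $T$; $\mathcal{P}(\mathbb{C})$ is the set of all subsets of $\mathbb{C}$. The symbol $\bigsqcup$ denotes disjoint union: $A = B \bigsqcup C$ means $A = B\cup C$ and $B\cap C=\emptyset$. A spectral valued function is a function $\Phi=(\Phi_1,\Phi_2): L(X)\to \mathcal{P}(\mathbb{C})\times\mathcal{P}(\mathbb{C})$ such that for every $S\in L(X)$, $\Phi_1(S)\subset\sigma(S)$ and $\Phi_2(S)\subset\sigma(S)$. A spectral valued function $\Phi$ is a spectral partitioning function for $T\in L(X)$ if $\sigma(T)=\Phi_1(T)\bigsqcup\Phi_2(T)$, and a spectral a-partitioning function for $T$ if $\sigma_a(T)=\Phi_1(T)\bigsqcup\Phi_2(T)$. For spectral valued functions $\Psi,\Phi$, write $\Psi\leq\Phi$ if for all $S\in L(X)$, $\Phi_1(S)\subset\Psi_1(S)$ and $\Psi_2(S)\subset\Phi_2(S)$. *)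

(* Defs.v *)
From mathcomp Require Import all_boot all_order all_algebra.
From mathcomp Require Import all_classical all_reals all_analysis.
From mathcomp Require Import complex.

Set Implicit Arguments.
Unset Strict Implicit.
Unset Printing Implicit Defensive.

Import Order.TTheory GRing.Theory Num.Theory.
Import numFieldNormedType.Exports.

Local Open Scope classical_set_scope.
Local Open Scope ring_scope.

(* The norm of a normed module over R[i] takes its values in R[i], in its
   nonnegative real part; the partial order of R[i] is the order of R there,
   so the bound M below is automatically real as soon as X is nonzero. *)
Record boundedOp (R : realType) (X : completeNormedModType R[i]) := BoundedOp {
  op_linear :> {linear X -> X};
  op_bounded : exists M : R[i], forall x : X, `|op_linear x| <= M * `|x|
}.

Definition op_shift (R : realType) (X : completeNormedModType R[i])
    (T : boundedOp X) (l : R[i]) : X -> X :=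
  fun x => T x - l *: x.

(* The inverse of T - l is required to lie in L(X), i.e. to be bounded. *)
Definition spectrum (R : realType) (X : completeNormedModType R[i])
    (T : boundedOp X) : set R[i] :=
  [set l | ~ exists S : boundedOp X,
               cancel (op_shift T l) S /\ cancel S (op_shift T l)].

Definition approx_point_spectrum (R : realType)
    (X : completeNormedModType R[i]) (T : boundedOp X) : set R[i] :=
  [set l | exists u : nat -> X,
             (forall n, `|u n| = 1) /\ op_shift T l (u n) @[n --> \oo] --> 0].

Definition disjoint_union (U : Type) (A B C : set U) : Prop :=
  A = B `|` C /\ B `&` C = set0.

Record spectralFun (R : realType) (X : completeNormedModType R[i]) :=
  SpectralFun {
    sfun :> boundedOp X -> set R[i] * set R[i];
    sfun_sub1 : forall S : boundedOp X, (sfun S).1 `<=` spectrum S;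
    sfun_sub2 : forall S : boundedOp X, (sfun S).2 `<=` spectrum S
  }.

Definition spectral_partitioning (R : realType)
    (X : completeNormedModType R[i]) (Phi : spectralFun X) (T : boundedOp X) :
    Prop :=
  disjoint_union (spectrum T) (Phi T).1 (Phi T).2.

Definition spectral_a_partitioning (R : realType)
    (X : completeNormedModType R[i]) (Phi : spectralFun X) (T : boundedOp X) :
    Prop :=
  disjoint_union (approx_point_spectrum T) (Phi T).1 (Phi T).2.

(* Psi <= Phi: the inclusion is reversed on the first component. *)
Definition sfun_le (R : realType) (X : completeNormedModType R[i])
    (Psi Phi : spectralFun X) : Prop :=
  forall S : boundedOp X,
    (Phi S).1 `<=` (Psi S).1 /\ (Psi S).2 `<=` (Phi S).2.

(* Main.v *)
Require Import Defs.
From mathcomp Require Import all_boot all_order all_algebra.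
From mathcomp Require Import all_classical all_reals all_analysis.
From mathcomp Require Import complex.

Set Implicit Arguments.
Unset Strict Implicit.
Unset Printing Implicit Defensive.

Import Order.TTheory GRing.Theory Num.Theory.
Import numFieldNormedType.Exports.

Local Open Scope classical_set_scope.
Local Open Scope ring_scope.

(** The spectra matter only as sets: what is left is a pointwise argument. In passing from [Phi] to
    [Psi], the second part gives up points and the first gains some; [Psi] partitions the spectrum
    exactly when the gain is what was given up plus what the approximate point spectrum misses. *)

Lemma disjoint_union_setD_iff (U : Type) (s a p1 p2 q1 q2 : set U) :
  p2 `<=` s -> q1 `<=` s -> disjoint_union a p1 p2 ->
  p1 `<=` q1 -> q2 `<=` p2 ->
  disjoint_union s q1 q2 <->
  disjoint_union (q1 `\` p1) (p2 `\` q2) (s `\` a).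
Proof.
move=> p2s q1s [-> p120] p1q1 q2p2.
have p12 x : p1 x -> p2 x -> False.
  by move=> ? ?; have : (p1 `&` p2) x by []; rewrite p120.
split=> -[E D].
- have q12 x : q1 x -> q2 x -> False.
    by move=> ? ?; have : (q1 `&` q2) x by []; rewrite D.
  have sq x : s x -> q1 x \/ q2 x by rewrite E.
  (* A point of [q1] outside [p1] either avoids [p2], hence [a], or lies in [p2] and avoids [q2].
     Conversely, a point of [s] outside [q2] must lie in [q1]. *)
  split; apply/seteqP; split=> x /=;
    move: (p2s x) (q1s x) (p12 x) (q12 x) (sq x) (p1q1 x) (q2p2 x);
    have := EM (p2 x); tauto.
- have qD x : (q1 x /\ ~ p1 x) <->
      (p2 x /\ ~ q2 x) \/ (s x /\ ~ (p1 x \/ p2 x)).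
    (* Refolding the conjunction as membership in a set difference lets [E] rewrite it. *)
    by have -> : (q1 x /\ ~ p1 x) = (q1 `\` p1) x by []; rewrite E.
  (* A point common to [q1] and [q2] is in [p2], so not in [p1]; then [qD] would put it outside [q2]
     or outside [p2]. *)
  split; apply/seteqP; split=> x /=;
    move: (p2s x) (q1s x) (p12 x) (qD x) (p1q1 x) (q2p2 x);
    have := EM (p1 x); have := EM (p2 x); have := EM (q2 x); tauto.
Qed.

Theorem theorem4p3 (R : realType) (X : completeNormedModType R[i])
    (T : boundedOp X) (Phi : spectralFun X)
    (hPhi : spectral_a_partitioning Phi T)
    (Psi : spectralFun X) (hle : sfun_le Psi Phi) :
  spectral_partitioning Psi T <->
  disjoint_union ((Psi T).1 `\` (Phi T).1)
    ((Phi T).2 `\` (Psi T).2)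
    (spectrum T `\` approx_point_spectrum T).
Proof.
have [p1q1 q2p2] := hle T.
exact: (disjoint_union_setD_iff (@sfun_sub2 _ _ Phi T) (@sfun_sub1 _ _ Psi T)
  hPhi p1q1 q2p2).
Qed.
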